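(* Let $\pi$ be a point-like solid partition, i.e. a finite subset of $\mathbb{Z}_{\geq 0}^4$ closed under passing to componentwise smaller elements. For every $i,j\in\{1,2,3,4\}$, $$(-1)^{\sigma_i(\pi)}\,e^{\mathbf{T}}(-\mathsf{v}^i_\pi)=(-1)^{\sigma_j(\pi)}\,e^{\mathbf{T}}(-\mathsf{v}^j_\pi),$$ where $\mathsf{v}^i_\pi$, $\sigma_i(\pi)$ and $e^{\mathbf{T}}$ are as defined in the context.
   Context: Torus and representation ring. $\mathbf{T}=\{t_1t_2t_3t_4=1\}\subset(\mathbb{C}^* )^4$, and $K^0_{\mathbf{T}}(\mathrm{pt})=\mathbb{Z}[t_1^{\pm1},t_2^{\pm1},t_3^{\pm1},t_4^{\pm1}]/(t_1t_2t_3t_4-1)$ is the ring of virtual $\mathbf{T}$-representations. $\overline{(\cdot)}$ denotes the dual, i.e. the ring involution $t_a\mapsto t_a^{-1}$. For a set of indices $I$, $P_I=\prod_{a\in I}(1-t_a)$, so $\overline{P_I}=\prod_{a\in I}(1-t_a^{-1})$. Movable classes and Euler class. A class $V=\sum_\mu m_\mu t^\mu\in K^0_{\mathbf{T}}(\mathrm{pt})$ (sum over distinct characters of $\mathbf{T}$, $m_\mu\in\mathbb{Z}$) is $\mathbf{T}$-movable if the trivial character has multiplicity $0$ in $V$. Put $\lambda_a=c_1^{\mathbf{T}}(t_a)$, so that $\lambda_1+\lambda_2+\lambda_3+\lambda_4=0$. For $\mathbf{T}$-movable $V$ the equivariant Euler class is $e^{\mathbf{T}}(V)=\prod_\mu(\mu_1\lambda_1+\mu_2\lambda_2+\mu_3\lambda_3+\mu_4\lambda_4)^{m_\mu}$,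 an element of the fraction field of $\mathbb{Q}[\lambda_1,\lambda_2,\lambda_3,\lambda_4]/(\lambda_1+\lambda_2+\lambda_3+\lambda_4)$. Solid partitions. A solid partition is a subset $\pi\subset\mathbb{Z}^4_{\geq0}$ such that if $\nu\in\pi$ and $0\le\nu'_a\le\nu_a$ for all $a$, then $\nu'\in\pi$. It is point-like if its four asymptotic plane partitions are empty, i.e. if $\pi$ is finite; then $|\pi|$ is its cardinality. Vertex terms. For finite $\pi$ put $Z_\pi=\sum_{(a_1,a_2,a_3,a_4)\in\pi}t_1^{a_1}t_2^{a_2}t_3^{a_3}t_4^{a_4}\in K^0_{\mathbf{T}}(\mathrm{pt})$. For $\{i,j,k,l\}=\{1,2,3,4\}$ define $$\mathsf{v}^i_\pi=Z_\pi-\overline{P_{jkl}}\,Z_\pi\overline{Z_\pi}.$$ (It is known that $\mathsf{v}^i_\pi$ is $\mathbf{T}$-movable, so $e^{\mathbf{T}}(-\mathsf{v}^i_\pi)$ is defined.) Sign. For $\{i,j,k,l\}=\{1,2,3,4\}$, $$\sigma_i(\pi)=|\pi|+\#\{(a_1,a_2,a_3,a_4)\in\pi:\ a_j=a_k=a_l<a_i\}.$$ *)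

(* Defs.v *)
From HB Require Import structures.
From mathcomp Require Import all_boot all_order all_algebra.
From mathcomp Require Import finmap.
From mathcomp Require Import monalg.
From mathcomp Require mpoly.

Set Implicit Arguments.
Unset Strict Implicit.
Unset Printing Implicit Defensive.

Import Order.TTheory GRing.Theory Num.Theory.
Local Open Scope fset_scope.
Local Open Scope quotient_scope.
Local Open Scope ring_scope.

(* Z[M] for an abelian group M written additively.  The product that monalg
   puts on {malg int[K]} is not available here, since it requires the monoid K
   to have no nontrivial units. *)
Definition group_ring (M : zmodType) : Type := {malg int[M]}.

Section GroupRing.
Variable M : zmodType.
Implicit Types (g : group_ring M) (k : M).

HB.instance Definition _ := GRing.Zmodule.copy (group_ring M) {malg int[M]}.

Definition gr_one : group_ring M := << 1 *g 0 >>.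

Definition gr_mul g1 g2 : group_ring M :=
  \sum_(k1 <- msupp g1) \sum_(k2 <- msupp g2)
     << g1@_k1 * g2@_k2 *g k1 + k2 >>.

Lemma gr_mulw (d1 d2 : {fset M}) g1 g2 :
  msupp g1 `<=` d1 -> msupp g2 `<=` d2 ->
  gr_mul g1 g2 = \sum_(k1 <- d1) \sum_(k2 <- d2)
     << g1@_k1 * g2@_k2 *g k1 + k2 >>.
Proof.
move=> le1 le2; rewrite /gr_mul (big_fset_incl _ le1) /=.
  apply: eq_bigr => k1 _; apply: big_fset_incl => // k _ /mcoeff_outdom ->.
  by rewrite mulr0 monalgU0.
move=> k _ /mcoeff_outdom g1k.
by rewrite big1 // => k' _; rewrite g1k mul0r monalgU0.
Qed.

Lemma gr_mulUU c1 c2 k1 k2 :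
  gr_mul << c1 *g k1 >> << c2 *g k2 >> = << c1 * c2 *g k1 + k2 >>.
Proof. by rewrite (gr_mulw msuppU_le msuppU_le) !big_seq_fset1 !mcoeffUU. Qed.

Lemma gr_mulC : commutative gr_mul.
Proof.
move=> g1 g2; rewrite /gr_mul exchange_big /=.
by do 2!apply: eq_bigr => ? _; rewrite mulrC addrC.
Qed.

Lemma gr_mulDl : left_distributive gr_mul +%R.
Proof.
move=> g1 g2 g; have sg := fsubset_refl (msupp g).
rewrite (gr_mulw (msuppD_le g1 g2) sg) (gr_mulw (fsubsetUl _ (msupp g2)) sg).
rewrite (gr_mulw (fsubsetUr (msupp g1) _) sg) -big_split /=.
apply: eq_bigr => k1 _; rewrite -big_split /=; apply: eq_bigr => k2 _.
by rewrite mcoeffD mulrDl monalgUD.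
Qed.

Lemma gr_mulDr : right_distributive gr_mul +%R.
Proof. by move=> g g1 g2; rewrite !(gr_mulC g) gr_mulDl. Qed.

Lemma gr_mul0g : left_zero 0 gr_mul.
Proof. by move=> g; rewrite /gr_mul msupp0 big_seq_fset0. Qed.

Lemma gr_mulg0 : right_zero 0 gr_mul.
Proof. by move=> g; rewrite gr_mulC gr_mul0g. Qed.

Lemma gr_mul_suml (I : Type) (r : seq I) (F : I -> group_ring M) g :
  gr_mul (\sum_(i <- r) F i) g = \sum_(i <- r) gr_mul (F i) g.
Proof. exact: (big_morph (gr_mul^~ g) (fun _ _ => gr_mulDl _ _ _) (gr_mul0g _)). Qed.

Lemma gr_mul_sumr (I : Type) (r : seq I) (F : I -> group_ring M) g :
  gr_mul g (\sum_(i <- r) F i) = \sum_(i <- r) gr_mul g (F i).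
Proof. exact: (big_morph (gr_mul g) (fun _ _ => gr_mulDr _ _ _) (gr_mulg0 _)). Qed.

Lemma gr_expand g : g = \sum_(k <- msupp g) (<< g@_k *g k >> : group_ring M).
Proof. exact: monalgE. Qed.

Lemma gr_mulA : associative gr_mul.
Proof.
move=> g1 g2 g3.
rewrite (gr_expand g1) (gr_expand g2) (gr_expand g3).
rewrite !gr_mul_suml; apply: eq_bigr => k1 _.
rewrite gr_mul_sumr [X in _ = gr_mul X _]gr_mul_sumr gr_mul_suml.
apply: eq_bigr => k2 _; rewrite !gr_mul_sumr; apply: eq_bigr => k3 _.
by rewrite !gr_mulUU mulrA addrA.
Qed.

Lemma gr_mul1g : left_id gr_one gr_mul.
Proof.
move=> g; rewrite [in RHS](gr_expand g) (gr_mulw msuppU_le (fsubset_refl _)).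
by rewrite big_seq_fset1; apply: eq_bigr => k _; rewrite mcoeffUU mul1r add0r.
Qed.

Lemma gr_one_neq0 : gr_one != 0.
Proof. by rewrite monalgU_eq0. Qed.

HB.instance Definition _ := GRing.Zmodule_isComNzRing.Build (group_ring M)
  gr_mulA gr_mulC gr_mul1g gr_mulDl gr_one_neq0.

End GroupRing.

(* The character lattice of T is Z^4 / Z(1,1,1,1). *)
Definition diagonal : {pred {ffun 'I_4 -> int}} :=
  [pred m : {ffun 'I_4 -> int} | [forall a, m a == m ord0]].

Lemma diagonal_zmod_closed : zmod_closed diagonal.
Proof.
split=> [|m n]; first by apply/forallP => a; rewrite !ffunE.
move=> /forallP mD /forallP nD; apply/forallP => a; rewrite !ffunE.
by rewrite (eqP (mD a)) (eqP (nD a)).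
Qed.

HB.instance Definition _ :=
  GRing.isZmodClosed.Build {ffun 'I_4 -> int} diagonal diagonal_zmod_closed.

(* {ideal_quot _} is the quotient of a zmodType by any additive subgroup. *)
Definition character : Type := {ideal_quot diagonal}.
HB.instance Definition _ := GRing.Zmodule.on character.
HB.instance Definition _ := EqQuotient.on character.

Definition char_of (m : {ffun 'I_4 -> int}) : character := \pi_character m.

Definition KT : comNzRingType := group_ring character.

Definition t (a : 'I_4) : KT :=
  << 1 *g char_of [ffun b => (b == a)%:Z] >>.

Definition dual (V : KT) : KT := \sum_(mu <- msupp V) << V@_mu *g - mu >>.

Definition P (I : {set 'I_4}) : KT := \prod_(a in I) (1 - t a).

Lemma KT_mulUU (c d : int) (mu nu : character) :
  (<< c *g mu >> : KT) * (<< d *g nu >> : KT) = << c * d *g mu + nu >>.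
Proof. exact: gr_mulUU. Qed.

Lemma char_ofD : {morph char_of : m n / m + n}.
Proof. by move=> m n; rewrite /char_of Quotient.pi_add. Qed.

Lemma char_of_eq0 m : (char_of m == 0) = (m \in diagonal).
Proof.
have <- : char_of 0 = 0 by apply: (addrI (char_of 0)); rewrite -char_ofD !addr0.
by rewrite -[m in RHS]subr0 Quotient.idealrBE.
Qed.

Lemma prod_t : \prod_(a < 4) t a = 1.
Proof.
rewrite !big_ord_recl big_ord0 mulr1 /t !KT_mulUU !mulr1.
rewrite -!char_ofD; congr << _ *g _ >>.
apply/eqP; rewrite char_of_eq0; apply/forallP => a; rewrite !ffunE.
by case: a => -[|[|[|[|]]]].
Qed.

Lemma dual_t a : dual (t a) * t a = 1.
Proof.
rewrite /dual /t msuppU /= big_seq_fset1 mcoeffUU KT_mulUU.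
by rewrite mulr1 addNr.
Qed.

(* Q[l_1,l_2,l_3,l_4]/(l_1+l_2+l_3+l_4), presented as the polynomial ring
   Q[l_1,l_2,l_3] with l_4 := -(l_1+l_2+l_3). *)
Section Cohomology.
(* Imported locally, as the notations of mpoly clash with those of monalg. *)
Import mpoly.

Definition HT : idomainType := mpoly 3 rat.

Definition lambda_HT (a : 'I_4) : HT :=
  if unlift ord_max a is Some b then 'X_b else - \sum_(b < 3) 'X_b.

End Cohomology.

Definition lambda (a : 'I_4) : {fraction HT} := tofrac (lambda_HT a).

Lemma sum_lambda : \sum_(a < 4) lambda a = 0.
Proof.
rewrite big_ord_recr /= /lambda /lambda_HT unlift_none rmorphN rmorph_sum /=.
apply/eqP; rewrite subr_eq0; apply/eqP; apply: eq_bigr => b _.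
rewrite (_ : widen_ord _ b = lift ord_max b) ?liftK //.
by apply: val_inj; rewrite /= /bump leqNgt ltn_ord.
Qed.

(* First Chern class of a character; by weight_char_of it does not depend on
   the chosen representative in Z^4. *)
Definition weight (mu : character) : {fraction HT} :=
  \sum_(a < 4) (repr mu a)%:~R * lambda a.

Lemma weight_char_of (m : {ffun 'I_4 -> int}) :
  weight (char_of m) = \sum_(a < 4) (m a)%:~R * lambda a.
Proof.
have: repr (char_of m) - m \in diagonal.
  by rewrite Quotient.idealrBE reprK.
move=> /forallP dP; apply/eqP; rewrite -subr_eq0 -sumrB; apply/eqP.
pose d := (repr (char_of m) - m) ord0.
rewrite (eq_bigr (fun a => d%:~R * lambda a)) => [|a _].
  by rewrite -mulr_sumr sum_lambda mulr0.
rewrite -mulrBl -rmorphB /=; congr (_%:~R * _).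
by rewrite /d; have := eqP (dP a); rewrite !ffunE.
Qed.

(* Meaningful for movable V only, i.e. if V@_0 = 0: then every mu in the
   support is a nontrivial character, so that weight mu != 0.  The exponent is
   an integer, and the product is taken in a field. *)
Definition euler (V : KT) : {fraction HT} :=
  \prod_(mu <- msupp V) weight mu ^ V@_mu.

Definition box : Type := {ffun 'I_4 -> nat}.
HB.instance Definition _ := Choice.copy box {ffun 'I_4 -> nat}.

(* Point-like means finite, which is encoded by the type {fset box}. *)
Definition pointlike_solid_partition (pi : {fset box}) : Prop :=
  forall nu nu' : box,
    nu \in pi -> (forall a, (nu' a <= nu a)%N) -> nu' \in pi.

Definition Z (pi : {fset box}) : KT :=
  \sum_(nu <- pi) \prod_(a < 4) t a ^+ nu a.

Definition v (i : 'I_4) (pi : {fset box}) : KT :=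
  Z pi - dual (P [set~ i]) * Z pi * dual (Z pi).

(* nu_j = nu_k = nu_l < nu_i, where {j, k, l} is the complement of {i}. *)
Definition on_diagonal_ray (i : 'I_4) (nu : box) : bool :=
  [forall j in [set~ i], (nu j < nu i)%N &&
     [forall k in [set~ i], nu j == nu k]].

Definition sigma (i : 'I_4) (pi : {fset box}) : nat :=
  (#|` pi| + #|` [fset nu in pi | on_diagonal_ray i nu]|)%N.

(* Main.v *)
Require Import Defs.
From mathcomp Require Import all_boot all_order all_algebra.
From mathcomp Require Import finmap.
From mathcomp Require Import monalg.
From mathcomp Require mpoly.
From mathcomp Require Import zify ring.

(** Let {i, j, k, l} = {1, 2, 3, 4} and write y_a for the dual of t_a.  The two
    vertex terms differ only through the factors (1 - y_j) and (1 - y_i) of the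
    dual of P_{jkl} and P_{ikl}, so that
      v_j - v_i = (y_i - y_j) (1 - y_k) (1 - y_l) Z dual(Z) = U - dual(U),
    where U = y_i (1 - y_k) (1 - y_l) Z dual(Z).  The second equality is the
    Calabi-Yau relation t_1 t_2 t_3 t_4 = 1, which gives
      dual(y_i (1 - y_k) (1 - y_l)) = y_j (1 - y_k) (1 - y_l)
    ([dual_half], [vertex_swap]).

    In U - dual(U) a character mu of U contributes the quotient of its weight by
    the weight of - mu, that is -1, unless mu is trivial, when mu and - mu
    cancel.  Hence e(U - dual U) = (-1)^(rk U - U_0), where U_0 is the
    multiplicity of the trivial character in U ([gr_euler_sub_dual]), and
    rk U = 0 because of the factor 1 - y_k ([aug_half]).  Since U - dual(U) has
    no trivial part, the Euler class is multiplicative when it is added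
    ([gr_eulerD]), and e(- v_i) = e(- v_j) (-1)^(U_0) ([gr_euler_swap]).

    It remains to see that U_0 and sigma_i + sigma_j have the same parity
    ([half_mult_sigma]).  This goes by induction on pi, adding a maximal box nu.
    By duality U_0 then grows by the multiplicities of the trivial character in
      y_i (1 - y_k) (1 - y_l) Z t^(-nu)  and  y_j (1 - y_k) (1 - y_l) Z t^(-nu).
    Each is an alternating sum of four numbers of boxes of pi on a diagonal line
    nu + b + Z (1, 1, 1, 1) with b a vector of zeros and ones.  As nu is a
    corner, these boxes are exactly the points of the line that are
    coordinatewise nonnegative and below nu, so that their number is the minimum
    of the coordinates of nu + b ([card_diagonal_translates]).  The alternating
    sum of these minima is 1 if nu_k = nu_l, nu_k <= nu_i and nu_k < nu_j, and 0
    otherwise ([half_mult_translates]); adding the same number with i and j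
    exchanged gives, modulo 2, the indicator of the condition that nu lies on
    one of the two rays that sigma_i and sigma_j count. *)

Set Implicit Arguments.
Unset Strict Implicit.
Unset Printing Implicit Defensive.

Import Order.TTheory GRing.Theory Num.Theory.
Local Open Scope fset_scope.
Local Open Scope ring_scope.

(** * Group rings: duality, augmentation and Euler classes *)

(** A constant of type [comNzRingType], as [KT] is: ring operations are then
    inferred along the same path for both, and unification stays first-order. *)
Definition gring (M : zmodType) : comNzRingType := group_ring M.

Section GroupRingTheory.
Variable M : zmodType.
Implicit Types (V W : gring M) (mu nu : M).

Definition mono mu : gring M := << 1 *g mu >>.

Definition gr_dual V : gring M := \sum_(mu <- msupp V) << V@_mu *g - mu >>.

(** The virtual rank. *)
Definition aug V : int := \sum_(mu <- msupp V) V@_mu.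

Definition triv_mult V : int := V@_(0 : M).

Lemma gr_UU (c d : int) mu nu :
  (<< c *g mu >> : gring M) * << d *g nu >> = << c * d *g mu + nu >>.
Proof. exact: gr_mulUU. Qed.

Lemma monoD mu nu : mono (mu + nu) = mono mu * mono nu.
Proof. by rewrite /mono gr_UU mulr1. Qed.

Lemma mono0 : mono 0 = 1.
Proof. by []. Qed.

Lemma triv_multD : {morph triv_mult : V W / V + W}.
Proof. by move=> V W; rewrite /triv_mult mcoeffD. Qed.

Lemma triv_multN : {morph triv_mult : V / - V}.
Proof. by move=> V; rewrite /triv_mult mcoeffN. Qed.

Lemma triv_mult0 : triv_mult 0 = 0.
Proof. exact: mcoeff0. Qed.

Lemma triv_mult_mono mu : triv_mult (mono mu) = (mu == 0)%:R.
Proof. by rewrite /triv_mult mcoeffU. Qed.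

Lemma triv_mult_sum (I : Type) (r : seq I) (F : I -> gring M) :
  triv_mult (\sum_(x <- r) F x) = \sum_(x <- r) triv_mult (F x).
Proof. exact: (big_morph _ triv_multD triv_mult0). Qed.

Lemma gr_ind (Q : gring M -> Prop) :
    Q 0 -> (forall V W, Q V -> Q W -> Q (V + W)) ->
  (forall c mu, Q << c *g mu >>) -> forall V, Q V.
Proof.
move=> Q0 QD QU V; rewrite (gr_expand V).
by apply: (big_ind Q Q0 QD) => mu _; apply: QU.
Qed.

Lemma gr_dual_coef V mu : (gr_dual V)@_mu = V@_(- mu).
Proof.
rewrite [in RHS](gr_expand V) /gr_dual !raddf_sum /=.
by apply: eq_bigr => k _; rewrite !mcoeffU eqr_oppLR.
Qed.

Lemma triv_mult_dual V : triv_mult (gr_dual V) = triv_mult V.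
Proof. by rewrite /triv_mult gr_dual_coef oppr0. Qed.

Lemma gr_dualD : {morph gr_dual : V W / V + W}.
Proof.
by move=> V W; apply/malgP => k; rewrite mcoeffD !gr_dual_coef mcoeffD.
Qed.

Lemma gr_dual0 : gr_dual 0 = 0.
Proof. by apply/malgP => k; rewrite gr_dual_coef !mcoeff0. Qed.

Lemma gr_dualN : {morph gr_dual : V / - V}.
Proof.
by move=> V; apply/malgP => k; rewrite mcoeffN !gr_dual_coef mcoeffN.
Qed.

Lemma gr_dualU (c : int) mu : gr_dual << c *g mu >> = << c *g - mu >>.
Proof. by apply/malgP => k; rewrite gr_dual_coef !mcoeffU eqr_oppLR. Qed.

Lemma gr_dual_mono mu : gr_dual (mono mu) = mono (- mu).
Proof. exact: gr_dualU. Qed.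

Lemma mono_dualK mu : mono mu * gr_dual (mono mu) = 1.
Proof. by rewrite gr_dual_mono -monoD subrr mono0. Qed.

Lemma gr_dual1 : gr_dual 1 = 1.
Proof. by rewrite -mono0 gr_dual_mono oppr0. Qed.

Lemma gr_dualM : {morph gr_dual : V W / V * W}.
Proof.
move=> V W; elim/gr_ind: V => [|V1 V2 IH1 IH2|c mu].
- by rewrite mul0r gr_dual0 mul0r.
- by rewrite mulrDl !gr_dualD IH1 IH2 mulrDl.
elim/gr_ind: W => [|W1 W2 IH1 IH2|d nu].
- by rewrite mulr0 gr_dual0 mulr0.
- by rewrite mulrDr !gr_dualD IH1 IH2 mulrDr.
by rewrite gr_UU !gr_dualU gr_UU opprD.
Qed.

Lemma gr_dualK : involutive gr_dual.
Proof. by move=> V; apply/malgP => k; rewrite !gr_dual_coef opprK. Qed.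

Lemma augD : {morph aug : V W / V + W}.
Proof.
have augw (d : {fset M}) V : msupp V `<=` d -> aug V = \sum_(mu <- d) V@_mu.
  by move=> le; apply: big_fset_incl => // k _ /mcoeff_outdom.
move=> V W; rewrite (augw _ _ (msuppD_le V W)).
rewrite (augw _ _ (fsubsetUl (msupp V) (msupp W))).
rewrite (augw _ _ (fsubsetUr (msupp V) (msupp W))).
by rewrite -big_split; apply: eq_bigr => k _; rewrite mcoeffD.
Qed.

Lemma aug0 : aug 0 = 0.
Proof. by rewrite /aug msupp0 big_seq_fset0. Qed.

Lemma augN : {morph aug : V / - V}.
Proof.
by move=> V; rewrite /aug msuppN -sumrN; apply: eq_bigr => k _; rewrite mcoeffN.
Qed.

Lemma augU (c : int) mu : aug << c *g mu >> = c.
Proof.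
rewrite /aug msuppU; have [->|_] := eqVneq c 0; first exact: big_seq_fset0.
by rewrite big_seq_fset1 mcoeffUU.
Qed.

Lemma aug_mono_mul mu V : aug (mono mu * V) = aug V.
Proof.
elim/gr_ind: V => [|V W IHV IHW|c nu]; first by rewrite mulr0.
  by rewrite mulrDr !augD IHV IHW.
by rewrite gr_UU !augU mul1r.
Qed.

Variables (F : fieldType) (w : M -> F).
Hypothesis wN : {morph w : mu / - mu}.
Hypothesis w_eq0 : forall mu, (w mu == 0) = (mu == 0).

Definition gr_euler V : F := \prod_(mu <- msupp V) w mu ^ V@_mu.

(** Only the trivial character has weight 0, where exponents do not add up, so
    that only the summand [W] has to be movable. *)
Lemma gr_eulerD V W : triv_mult W = 0 ->
  gr_euler (V + W) = gr_euler V * gr_euler W.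
Proof.
have ew (d : {fset M}) V' :
    msupp V' `<=` d -> gr_euler V' = \prod_(mu <- d) w mu ^ V'@_mu.
  by move=> le; apply: big_fset_incl => // k _ /mcoeff_outdom ->; rewrite expr0z.
move=> W0; rewrite (ew _ _ (msuppD_le V W)).
rewrite (ew _ _ (fsubsetUl (msupp V) (msupp W))).
rewrite (ew _ _ (fsubsetUr (msupp V) (msupp W))).
rewrite -big_split; apply: eq_bigr => k _; rewrite mcoeffD.
have [->|k0] := eqVneq k 0; last by rewrite expfzDr // w_eq0.
by move: W0; rewrite /triv_mult => ->; rewrite addr0 expr0z /= mulr1.
Qed.

Lemma gr_euler0 : gr_euler 0 = 1.
Proof. by rewrite /gr_euler msupp0 big_seq_fset0. Qed.

Lemma gr_eulerU (c : int) mu : gr_euler << c *g mu >> = w mu ^ c.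
Proof.
rewrite /gr_euler msuppU; have [->|_] := eqVneq c 0.
  by rewrite big_seq_fset0 expr0z.
by rewrite big_seq_fset1 mcoeffUU.
Qed.

(** Both sides turn sums into products, and on a nontrivial character [mu] the
    left-hand side is [w mu / w (- mu) = -1]. *)
Lemma gr_euler_sub_dual V :
  gr_euler (V - gr_dual V) = (-1) ^ (aug V - triv_mult V).
Proof.
have dual_triv U : triv_mult (U - gr_dual U) = 0.
  by rewrite triv_multD triv_multN triv_mult_dual subrr.
have N1 : (-1 : F) != 0 by rewrite oppr_eq0 oner_eq0.
elim/gr_ind: V => [|V W IHV IHW|c mu].
- by rewrite gr_dual0 subr0 gr_euler0 aug0 triv_mult0 subr0.
- rewrite gr_dualD opprD addrACA gr_eulerD // IHV IHW augD triv_multD.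
  by rewrite -expfzDr //; congr (_ ^ _); ring.
rewrite gr_dualU -monalgUN augU /triv_mult mcoeffU.
have [->|mu0] := eqVneq mu 0.
  by rewrite oppr0 -monalgUD subrr monalgU0 gr_euler0.
rewrite gr_eulerD ?gr_eulerU; last first.
  by rewrite /triv_mult mcoeffU oppr_eq0 (negPf mu0).
rewrite mulr0n subr0 wN -[in X in _ * X]mulN1r expfzMl mulrCA -expfzDr ?w_eq0 //.
rewrite subrr expr0z mulr1.
by rewrite -exprz_inv invrN1.
Qed.

End GroupRingTheory.

(** * The difference of two vertex terms *)

(** With [ya] the dual of [t a], the difference of two vertex terms is
    U - dual(U), where U is this element times S dual(S). *)
Definition half_diff (R : comNzRingType) (yi yk yl : R) : R :=
  yi * ((1 - yk) * (1 - yl)).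

Lemma half_expand (R : comNzRingType) (c : R -> int)
    (yi yk yl yik yil yikl X : R) :
    {morph c : x y / x + y} -> {morph c : x / - x} ->
    yi * yk = yik -> yi * yl = yil -> yik * yl = yikl ->
  c (half_diff yi yk yl * X) = c (yi * X) - c (yik * X) - c (yil * X) + c (yikl * X).
Proof.
move=> cD cN yikE yilE yiklE; rewrite -!cN -!cD; congr c.
by rewrite -yiklE -yilE -yikE /half_diff; ring.
Qed.

(** [R], [d] and [c] stand for the representation ring of the torus, its duality
    and the multiplicity of the trivial character, and [ya] for the dual of
    [t a]. *)
Section HalfDiff.
Variable R : comNzRingType.
Variables (d : R -> R) (c : R -> int).
Hypotheses (dD : {morph d : x y / x + y}) (dM : {morph d : x y / x * y}).
Hypotheses (dN : {morph d : x / - x}) (d1 : d 1 = 1) (dK : involutive d).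
Hypotheses (cD : {morph c : x y / x + y}) (cd : forall x, c (d x) = c x).

Variables yi yj yk yl : R.
Hypotheses (yjK : yj * d yj = 1) (ykK : yk * d yk = 1) (ylK : yl * d yl = 1).
Hypothesis prod1 : yi * yj * yk * yl = 1.

(** By [prod1] the dual of [yi] is [yj * yk * yl], and [yk * (1 - d yk)] is
    [- (1 - yk)]; the two signs, from k and from l, cancel. *)
Lemma dual_half : d (half_diff yi yk yl) = half_diff yj yk yl.
Proof.
have yjE : yj = d yi * d yk * d yl.
  by rewrite -[LHS]mulr1 -d1 -prod1 !dM -[RHS]mul1r -yjK; ring.
rewrite /half_diff !dM !dD !dN d1 [in RHS]yjE.
transitivity (d yi * ((d yk - yk * d yk) * (d yl - yl * d yl))); last ring.
by rewrite ykK ylK; ring.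
Qed.

(** Adding one monomial [m] to [S] changes [S * d S] by [S * d m], [m * d S] and
    [1].  The term with [m * d S] is replaced by its dual, which exchanges [yi]
    and [yj]. *)
Lemma half_norm_add S m : m * d m = 1 -> c (half_diff yi yk yl) = 0 ->
  c (half_diff yi yk yl * ((S + m) * d (S + m))) =
  c (half_diff yi yk yl * (S * d S)) +
  (c (half_diff yi yk yl * (S * d m)) + c (half_diff yj yk yl * (S * d m))).
Proof.
move: dual_half; set A := half_diff yi yk yl; set B := half_diff yj yk yl.
move=> dA mK c0; have -> : A * ((S + m) * d (S + m)) =
    A * (S * d S) + (A * (S * d m) + A * (m * d S)) + A.
  transitivity (A * (S * d S) + (A * (S * d m) + A * (m * d S)) + A * (m * d m)).
    by rewrite dD; ring.
  by rewrite mK mulr1.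
rewrite !cD c0 addr0 -(cd (A * (m * d S))) (dM A) dA dM dK.
by rewrite [d m * S]mulrC.
Qed.

Lemma vertex_swap S :
  - (S - (1 - yj) * ((1 - yk) * (1 - yl)) * S * d S) =
  - (S - (1 - yi) * ((1 - yk) * (1 - yl)) * S * d S) +
  (half_diff yi yk yl * (S * d S) - d (half_diff yi yk yl * (S * d S))).
Proof. by rewrite dM dual_half dM dK /half_diff; ring. Qed.

End HalfDiff.

Section Swap.
Variables (M : zmodType) (yi yj yk yl : gring M).
Hypotheses (yjK : yj * gr_dual yj = 1) (ykK : yk * gr_dual yk = 1).
Hypotheses (ylK : yl * gr_dual yl = 1) (prod1 : yi * yj * yk * yl = 1).
Hypothesis aug_yk : forall V, aug (yk * V) = aug V.
Variables (F : fieldType) (w : M -> F).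
Hypothesis wN : {morph w : mu / - mu}.
Hypothesis w_eq0 : forall mu, (w mu == 0) = (mu == 0).

Lemma aug_half V : aug (half_diff yi yk yl * V) = 0.
Proof.
have -> : half_diff yi yk yl * V
    = yi * (1 - yl) * V - yk * (yi * (1 - yl) * V) by rewrite /half_diff; ring.
by rewrite augD augN aug_yk subrr.
Qed.

Lemma gr_euler_swap (S : gring M) :
  gr_euler w (- (S - (1 - yj) * ((1 - yk) * (1 - yl)) * S * gr_dual S)) =
  gr_euler w (- (S - (1 - yi) * ((1 - yk) * (1 - yl)) * S * gr_dual S)) *
  (-1) ^ triv_mult (half_diff yi yk yl * (S * gr_dual S)).
Proof.
have E := vertex_swap (@gr_dualD M) (@gr_dualM M) (@gr_dualN M) (@gr_dual1 M)
  (@gr_dualK M) yjK ykK ylK prod1 S.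
apply: (etrans (congr1 (gr_euler w) E)).
set U := half_diff _ _ _ * _.
rewrite (gr_eulerD w_eq0); last first.
  by rewrite triv_multD triv_multN triv_mult_dual subrr.
rewrite (gr_euler_sub_dual wN w_eq0 U) [aug U]aug_half.
by rewrite sub0r -exprz_inv invrN1.
Qed.

End Swap.

(** * Weights of characters *)

Lemma char_ofN m : char_of (- m) = - char_of m.
Proof.
apply/eqP; rewrite -addr_eq0 -char_ofD addNr char_of_eq0.
by apply/forallP => a; rewrite !ffunE.
Qed.

Lemma weightN mu : weight (- mu) = - weight mu.
Proof.
have -> : mu = char_of (repr mu) by rewrite /char_of reprK.
rewrite -char_ofN !weight_char_of -sumrN.
by apply: eq_bigr => a _; rewrite ffunE rmorphN mulNr.
Qed.

Section LambdaFree.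
Import mpoly.

(** As l_4 is minus the sum of the three variables, evaluation at the b-th unit
    vector sends a linear form to the difference of its b-th and last
    coefficients. *)
Lemma lambda_free (m : {ffun 'I_4 -> int}) :
  \sum_(a < 4) (m a)%:~R * lambda a = 0 -> m \in diagonal.
Proof.
pose S : HT := \sum_(a < 4) (m a)%:~R * lambda_HT a.
have -> : \sum_(a < 4) (m a)%:~R * lambda a = tofrac S.
  by rewrite rmorph_sum; apply: eq_bigr => a _; rewrite rmorphM /= rmorph_int.
move/eqP; rewrite tofrac_eq0 => /eqP S0.
have Xcoef (b : 'I_3) : m (lift ord_max b) = m ord_max.
  pose ev : HT -> rat := meval (fun b' => (b' == b)%:R).
  have delta1 : \sum_(b' < 3) (b' == b)%:R = 1 :> rat.
    by rewrite (bigD1 b) //= eqxx big1 ?addr0 // => b' /negPf ->.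
  have ev_lift b' : ev (lambda_HT (lift ord_max b')) = (b' == b)%:R.
    by rewrite /lambda_HT liftK /ev mevalXU.
  have ev_max : ev (lambda_HT ord_max) = -1.
    rewrite /lambda_HT unlift_none /ev mevalN -[in RHS]delta1; congr (- _).
    by rewrite raddf_sum; apply: eq_bigr => b' _; exact: mevalXU.
  have : ev S = 0 by rewrite S0 /ev meval0.
  rewrite /S /ev raddf_sum big_ord_recr /=.
  under eq_bigr => b' _.
    rewrite (_ : widen_ord _ b' = lift ord_max b'); last first.
      by apply: val_inj; rewrite /= /bump leqNgt ltn_ord.
    rewrite mevalM [X in _ * X]ev_lift rmorph_int; over.
  rewrite mevalM rmorph_int [X in _ + _ * X]ev_max (bigD1 b) //= eqxx.
  rewrite big1 => [|b' /negPf ->]; last by rewrite mulr0.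
  by rewrite addr0 mulr1 mulrN1 => /eqP; rewrite subr_eq0 eqr_int => /eqP.
have mE a : m a = m ord_max.
  by case: (unliftP ord_max a) => [b ->|-> //]; apply: Xcoef.
by apply/forallP => a; rewrite mE (mE ord0).
Qed.

End LambdaFree.

Lemma weight_eq0 mu : (weight mu == 0) = (mu == 0).
Proof.
have -> : mu = char_of (repr mu) by rewrite /char_of reprK.
rewrite char_of_eq0; apply/eqP/idP; rewrite weight_char_of.
  exact: lambda_free.
move=> /forallP mD; rewrite (eq_bigr (fun a => (repr mu ord0)%:~R * lambda a)).
  by rewrite -mulr_sumr sum_lambda mulr0.
by move=> a _; rewrite (eqP (mD a)).
Qed.

(** * Enumerations of the four indices *)

Lemma ord4_list (i j k l : 'I_4) : uniq [:: i; j; k; l] ->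
  perm_eq (index_enum 'I_4) [:: i; j; k; l].
Proof.
move=> Us; apply: uniq_perm (index_enum_uniq _) (Us) _ => a.
rewrite mem_index_enum.
have /subset_cardP : #|[:: i; j; k; l]| = #|'I_4|.
  by rewrite (card_uniqP Us) card_ord.
by move/(_ (subset_predT _))=> ->.
Qed.

Lemma uniq_swap (i j k l : 'I_4) :
  uniq [:: i; j; k; l] -> uniq [:: j; i; k; l].
Proof.
rewrite /= !inE !negb_or (eq_sym j i).
by move=> /and4P[/and3P[-> -> ->] /andP[-> ->] -> _].
Qed.

Lemma ord4_complete (i j : 'I_4) : i != j ->
  exists k l, uniq [:: i; j; k; l].
Proof.
move=> ij; have : #|~: [set i; j]| == 2.
  by rewrite cardsCs setCK cards2 ij card_ord.
move/cards2P => [k [l [kl ijE]]]; exists k, l.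
have : k \in ~: [set i; j] by rewrite ijE !inE eqxx.
have : l \in ~: [set i; j] by rewrite ijE !inE eqxx orbT.
rewrite !inE !negb_or !(eq_sym k) !(eq_sym l) => /andP[il jl] /andP[ik jk].
by rewrite /= !inE !negb_or ij ik il jk jl kl.
Qed.

Lemma mem_ord4 (i j k l a : 'I_4) : uniq [:: i; j; k; l] ->
  a \in [:: i; j; k; l].
Proof. by move=> Us; rewrite -(perm_mem (ord4_list Us)) mem_index_enum. Qed.

Lemma prod_compl1 (R : comNzRingType) (f : 'I_4 -> R) (i j k l : 'I_4) :
  uniq [:: i; j; k; l] -> \prod_(a in [set~ i]) f a = f j * (f k * f l).
Proof.
move=> Us; rewrite big_mkcond (perm_big _ (ord4_list Us)) /=.
move: Us; rewrite /= !inE !negb_or => /and4P[/and3P[ij ik il] _ _ _].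
rewrite !big_cons big_nil !inE eqxx /= (eq_sym j) (eq_sym k) (eq_sym l).
by rewrite (negPf ij) (negPf ik) (negPf il) /= mul1r mulr1.
Qed.

(** * Solid partitions *)

Lemma box_ext (x y : box) : (forall a : 'I_4, x a = y a) -> x = y.
Proof. by move=> xy; apply/ffunP. Qed.

(** A box with largest coordinate sum is maximal. *)
Lemma box_max (pi : {fset box}) : pi != fset0 ->
  exists2 nu, nu \in pi &
    forall x, x \in pi -> (forall a, (nu a <= x a)%N) -> x = nu.
Proof.
case/fset0Pn => x0 x0pi.
pose h (x : pi) := (\sum_(a < 4) val x a)%N.
case: (arg_maxnP h (erefl : xpredT [` x0pi])) => nu _ numax.
exists (val nu); first exact: valP.
move=> x xpi nux; apply/ffunP => a; apply/eqP.
have := numax [` xpi] isT; rewrite /h /= leqNgt.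
have [//|xa] := eqVneq; rewrite (bigD1 a) //= [ltnRHS](bigD1 a) //= -addSn.
rewrite leq_add //; last by apply: leq_sum => b _; apply: nux.
by rewrite ltn_neqAle eq_sym xa nux.
Qed.

(** Removing a maximal box from a solid partition leaves a solid partition. *)
Lemma solid_partition_ind (Q : {fset box} -> Prop) :
    Q fset0 ->
    (forall nu pi, pointlike_solid_partition pi ->
       pointlike_solid_partition (nu |` pi) -> nu \notin pi ->
       Q pi -> Q (nu |` pi)) ->
  forall pi, pointlike_solid_partition pi -> Q pi.
Proof.
move=> Q0 QU pi; have [n] := ubnP #|` pi|; elim: n pi => // n IH pi lepi hpi.
have [->//|/box_max[nu nupi numax]] := eqVneq pi fset0.
have hpi' : pointlike_solid_partition (pi `\ nu).
  move=> x y; rewrite !in_fsetD1 => /andP[xnu xpi] yx.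
  rewrite (hpi _ _ xpi yx) andbT; apply: contraNneq xnu => ynu.
  by apply/eqP/numax => // a; rewrite -ynu.
rewrite -(fsetD1K nupi); apply: QU => //; rewrite ?fsetD1K ?in_fsetD1 ?eqxx //.
by apply: IH => //; move: lepi; rewrite (cardfsD1 nu) nupi; lia.
Qed.

Definition offset (x nu : box) (b : 'I_4 -> bool) : {ffun 'I_4 -> int} :=
  [ffun a => (x a)%:Z - (nu a)%:Z - (b a)%:Z].

(** The boxes counted are the [nu + b - (n + 1) (1, 1, 1, 1)] with all
    coordinates nonnegative and [n] a natural number, so that [N] is the minimum
    of the coordinates of [nu + b].  They lie in [pi], being below [nu] and
    distinct from it in the coordinate [i] where [b] vanishes; a box of [pi] of
    the form [nu + b + n (1, 1, 1, 1)] would put [nu] itself in [pi]. *)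
Lemma card_diagonal_translates (nu : box) pi (b : 'I_4 -> bool) i N :
    pointlike_solid_partition pi -> pointlike_solid_partition (nu |` pi) ->
    nu \notin pi -> ~~ b i ->
    (forall n, (n < N)%N <-> forall a, (n < nu a + b a)%N) ->
  #|` [fset x in pi | offset x nu b \in diagonal]| = N.
Proof.
move=> hpi hnupi nupi bi NP.
pose low n : box := [ffun a => nu a + b a - n.+1]%N.
have lowE n a : low n a = (nu a + b a - n.+1)%N by rewrite ffunE.
have -> : [fset x in pi | offset x nu b \in diagonal]
          = [fset low n | n in iota 0 N].
  apply/fsetP => x; rewrite !inE /=; apply/andP/imfsetP => /=.
    move=> [xpi /forallP xD].
    have {}xD a : (x a)%:Z - (nu a)%:Z - (b a)%:Z = offset x nu b i :> int.
      by rewrite (eqP (xD i)) -(eqP (xD a)) ffunE.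
    move: (offset x nu b i) xD => d xD; have [d0|d0] : 0 <= d \/ d < 0 by lia.
      case/negP: nupi.
      by apply: (hpi x) => // a; have := xD a; lia.
    exists (absz d).-1.
      rewrite mem_iota add0n; apply/NP => a; have := xD a; lia.
    apply: box_ext => a; rewrite lowE; have := xD a; lia.
  move=> [n]; rewrite mem_iota add0n => /= /NP nN ->.
  have xpi : low n \in nu |` pi.
    apply: (hnupi nu); first by rewrite fset1U1.
    by move=> a; rewrite lowE; have := nN a; case: (b a); lia.
  split.
    move: xpi; rewrite in_fset1U => /orP[/eqP lown|//].
    by have := lowE n i; rewrite lown; have := nN i; rewrite (negPf bi); lia.
  by apply/forallP => a; rewrite !ffunE; have := nN a; have := nN ord0; lia.
rewrite card_in_imfset /= ?undup_id ?iota_uniq ?size_iota // => n n'.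
rewrite !mem_iota !add0n => /NP nN /NP n'N.
have := nN i; have := n'N i; move=> + + /ffunP/(_ i); rewrite !lowE.
by rewrite (negPf bi); lia.
Qed.

(** * The representation ring of the torus *)

Lemma dual_KTM : {morph dual : V W / V * W}.
Proof. exact: (@gr_dualM character). Qed.

Lemma dual_1Bt a : dual (1 - t a) = 1 - dual (t a).
Proof.
apply: (etrans (gr_dualD _ _)).
by rewrite gr_dualN gr_dual1.
Qed.

Lemma dual_P_compl1 (i j k l : 'I_4) : uniq [:: i; j; k; l] ->
  dual (P [set~ i]) =
    (1 - dual (t j)) * ((1 - dual (t k)) * (1 - dual (t l))).
Proof.
move=> Us; rewrite /P (prod_compl1 _ Us) (dual_KTM (1 - t j)) (dual_KTM (1 - t k)).
by rewrite (dual_1Bt j) (dual_1Bt k) (dual_1Bt l).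
Qed.

Definition lattice_mono (m : {ffun 'I_4 -> int}) : KT := mono (char_of m).

Lemma lattice_monoD : {morph lattice_mono : m n / m + n >-> m * n}.
Proof. by move=> m n; rewrite /lattice_mono char_ofD monoD. Qed.

Lemma lattice_mono0 : lattice_mono 0 = 1.
Proof.
rewrite /lattice_mono (_ : char_of 0 = 0) //.
by apply: (addrI (char_of 0)); rewrite -char_ofD !addr0.
Qed.

Lemma lattice_monoMn m n : lattice_mono (m *+ n) = lattice_mono m ^+ n.
Proof.
elim: n => [|n IHn]; first by rewrite lattice_mono0.
by rewrite mulrS lattice_monoD IHn exprS.
Qed.

Lemma t_lattice_mono a : t a = lattice_mono [ffun b => (b == a)%:Z].
Proof. by []. Qed.

Definition position (x : box) : {ffun 'I_4 -> int} := [ffun a => (x a)%:Z].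

Lemma Z_lattice_mono pi : Z pi = \sum_(x <- pi) lattice_mono (position x).
Proof.
apply: eq_bigr => x _.
under eq_bigr => a _ do rewrite t_lattice_mono -lattice_monoMn.
rewrite -(big_morph lattice_mono lattice_monoD lattice_mono0); congr lattice_mono.
apply/ffunP => b; rewrite sum_ffunE (bigD1 b) //= big1 ?addr0 => [|a /negPf ab].
  by rewrite ffunMnE !ffunE eqxx -mulr_natr mul1r natz.
by rewrite ffunMnE !ffunE eq_sym ab mul0rn.
Qed.

Definition indicator (s : seq 'I_4) : {ffun 'I_4 -> int} :=
  [ffun a => (a \in s)%:Z].

Lemma dual_lattice_mono m : dual (lattice_mono m) = lattice_mono (- m).
Proof. by rewrite /lattice_mono char_ofN; exact: gr_dual_mono. Qed.

Lemma dual_t_indicator i : dual (t i) = lattice_mono (- indicator [:: i]).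
Proof.
rewrite t_lattice_mono dual_lattice_mono; congr lattice_mono; apply/ffunP => a.
by rewrite !ffunE inE.
Qed.

Lemma dual_t_cons i s : i \notin s ->
  lattice_mono (- indicator s) * dual (t i) = lattice_mono (- indicator (i :: s)).
Proof.
move=> si; rewrite t_lattice_mono dual_lattice_mono -lattice_monoD.
congr lattice_mono; apply/ffunP => a; rewrite !ffunE inE.
have [->|_] := eqVneq a i; first by rewrite (negPf si) oppr0 add0r.
by rewrite oppr0 addr0.
Qed.

Lemma triv_mult_lattice_mono m : triv_mult (lattice_mono m) = (m \in diagonal)%:R.
Proof. by rewrite triv_mult_mono char_of_eq0. Qed.

Lemma prod_dual_t (i j k l : 'I_4) : uniq [:: i; j; k; l] ->
  dual (t i) * dual (t j) * dual (t k) * dual (t l) = 1.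
Proof.
move=> Us; transitivity (dual (t i * (t j * (t k * t l)))).
  rewrite (dual_KTM (t i)) (dual_KTM (t j)) (dual_KTM (t k)).
  by rewrite -!mulrA.
have <- : \prod_a t a = t i * (t j * (t k * t l)).
  rewrite (perm_big _ (ord4_list Us)) /= !big_cons big_nil.
  by congr (_ * (_ * (_ * _))); exact: mulr1.
by rewrite prod_t; exact: gr_dual1.
Qed.

Lemma dual_KTK : involutive dual.
Proof. exact: (@gr_dualK character). Qed.

Lemma dual_tK a : dual (t a) * dual (dual (t a)) = 1.
Proof. by rewrite dual_KTK dual_t. Qed.

(** * The multiplicity of the trivial character *)

Definition translates (pi : {fset box}) (nu : box) (s : seq 'I_4) : nat :=
  #|` [fset x in pi | offset x nu (fun a => a \in s) \in diagonal]|.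

(** A monomial contributes exactly when its exponent lies on the diagonal. *)
Lemma triv_mult_translates pi nu s :
  triv_mult (lattice_mono (- indicator s) *
             (Z pi * lattice_mono (- position nu))) =
  (translates pi nu s)%:Z.
Proof.
rewrite Z_lattice_mono mulr_suml mulr_sumr triv_mult_sum.
transitivity (\sum_(x <- pi) (offset x nu (fun a => a \in s) \in diagonal)%:Z).
  apply: eq_bigr => x _; rewrite -!lattice_monoD triv_mult_lattice_mono natz.
  congr (_ \in diagonal)%:Z; apply/ffunP => a; rewrite !ffunE; ring.
rewrite /translates -sum1_size big_fset /= [in RHS]big_mkcond /=.
rewrite (big_morph Posz PoszD (erefl _)).
by apply: eq_bigr => x _; case: (_ \in diagonal).
Qed.

Lemma translatesE pi nu (i j k l : 'I_4) s : uniq [:: i; j; k; l] ->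
    pointlike_solid_partition pi -> pointlike_solid_partition (nu |` pi) ->
    nu \notin pi -> j \notin s ->
  translates pi nu s =
    minn (minn (nu i + (i \in s)) (nu j)) (minn (nu k + (k \in s)) (nu l + (l \in s))).
Proof.
move=> Us hpi hnupi nupi js.
apply: (@card_diagonal_translates nu pi (fun a => a \in s) j) => // n.
have js0 : (j \in s) = false := negPf js.
split=> [nN a|nN]; last first.
  have := nN i; have := nN j; have := nN k; have := nN l; rewrite /= js0; lia.
by have := mem_ord4 a Us; rewrite !inE => /or4P[] /eqP ->; rewrite /= ?js0; lia.
Qed.

(** For [X = Z pi * dual (Z pi)] this is the number U_0 that decides the sign
    between the Euler classes of the two vertex terms. *)
Definition half_mult i k l (X : KT) : int :=
  triv_mult (half_diff (dual (t i)) (dual (t k)) (dual (t l)) * X).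

Lemma half_mult_indicator (i j k l : 'I_4) (X : KT) : uniq [:: i; j; k; l] ->
  half_mult i k l X =
    triv_mult (lattice_mono (- indicator [:: i]) * X) -
    triv_mult (lattice_mono (- indicator [:: k; i]) * X) -
    triv_mult (lattice_mono (- indicator [:: l; i]) * X) +
    triv_mult (lattice_mono (- indicator [:: l; k; i]) * X).
Proof.
rewrite /= !inE !negb_or => /and4P[/and3P[ij ik il] /andP[jk jl] kl _].
rewrite /half_mult (dual_t_indicator i); apply: half_expand.
- exact: triv_multD.
- exact: triv_multN.
- by apply: dual_t_cons; rewrite inE eq_sym.
- by apply: dual_t_cons; rewrite inE eq_sym.
- by apply: dual_t_cons; rewrite !inE negb_or !(eq_sym l) kl il.
Qed.

(** Each of the four monomials has exponent -1 at [i] and 0 at [j], hence is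
    nontrivial. *)
Lemma half_mult1 (i j k l : 'I_4) : uniq [:: i; j; k; l] ->
  half_mult i k l 1 = 0.
Proof.
move=> Us; rewrite (half_mult_indicator _ Us).
have nd s : i \in s -> j \notin s -> triv_mult (lattice_mono (- indicator s) * 1) = 0.
  move=> si sj; rewrite mulr1 triv_mult_lattice_mono.
  have [/forallP D|//] := boolP (- indicator s \in diagonal).
  by have := eqP (D i); rewrite -(eqP (D j)) !ffunE si (negPf sj).
move: Us; rewrite /= !inE !negb_or => /and4P[/and3P[ij ik il] /andP[jk jl] kl _].
transitivity (0 - 0 - 0 + 0 : int) => //; congr (_ - _ - _ + _); apply: nd.
all: by rewrite !inE ?negb_or ?eqxx ?orbT // (eq_sym j i) ?ij ?jk ?jl.
Qed.

(** With [c] the minimum of [nu i + 1] and [nu j], the left-hand side is the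
    mixed second difference at [(nu k, nu l)] of the function [min c x y] of [x]
    and [y], which is 1 for [x = y < c] and 0 elsewhere. *)
Lemma half_mult_translates pi nu (i j k l : 'I_4) : uniq [:: i; j; k; l] ->
    pointlike_solid_partition pi -> pointlike_solid_partition (nu |` pi) ->
    nu \notin pi ->
  half_mult i k l (Z pi * lattice_mono (- position nu)) =
    [&& nu k == nu l, nu k <= nu i & nu k < nu j]%N%:Z.
Proof.
move=> Us hpi hnupi nupi; rewrite (half_mult_indicator _ Us).
pose T s := (translates pi nu s)%:Z.
transitivity (T [:: i] - T [:: k; i] - T [:: l; i] + T [:: l; k; i]).
  by congr (_ - _ - _ + _); apply: triv_mult_translates.
have E s := translatesE (s := s) Us hpi hnupi nupi.
move: Us; rewrite /= !inE !negb_or => /and4P[/and3P[ij ik il] /andP[jk jl] kl _].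
rewrite /T !E ?inE ?negb_or ?eqxx // ?(eq_sym j i) ?ij ?jk ?jl //.
rewrite !(eq_sym k) !(eq_sym l) (negPf ik) (negPf il) (negPf kl) /=.
lia.
Qed.

Lemma on_diagonal_rayE (i j k l : 'I_4) nu : uniq [:: i; j; k; l] ->
  on_diagonal_ray i nu = [&& nu j == nu k, nu k == nu l & nu l < nu i]%N.
Proof.
move=> Us; move: (Us); rewrite /= !inE !negb_or => /and4P[/and3P[ij ik il] _ _ _].
apply/forallP/idP => [ray|/and3P[/eqP ejk /eqP ekl lti] a].
  have rayE a b : a != i -> b != i -> (nu a < nu i)%N /\ nu a = nu b.
    move=> ai bi; have := ray a; rewrite !inE ai => /andP[-> /forallP/(_ b)].
    by rewrite !inE bi => /eqP.
  rewrite eq_sym in ij; rewrite eq_sym in ik; rewrite eq_sym in il.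
  have [_ ->] := rayE j k ij ik; have [_ ->] := rayE k l ik il.
  by have [-> _] := rayE l l il il; rewrite eqxx.
have nuE b : b != i -> nu b = nu l.
  by have := mem_ord4 b Us; rewrite !inE => /or4P[]/eqP->; rewrite ?eqxx ?ejk ?ekl.
rewrite !inE; apply/implyP => ai; rewrite (nuE a ai) lti.
by apply/forallP => b; rewrite !inE; apply/implyP => bi; rewrite (nuE b bi).
Qed.

Lemma sigma_fsetU1 i nu pi : nu \notin pi ->
  sigma i (nu |` pi) = (sigma i pi + 1 + on_diagonal_ray i nu)%N.
Proof.
move=> nupi; rewrite /sigma cardfsU1 nupi.
have cE (A : {fset box}) : #|` [fset x in A | on_diagonal_ray i x]|
            = (\sum_(x <- A) on_diagonal_ray i x)%N.
  rewrite -sum1_size big_fset /= [LHS]big_mkcond.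
  by apply: eq_bigr => x _; case: (on_diagonal_ray i x).
by rewrite !cE big_fsetU1 //=; lia.
Qed.

(** The box [nu] adds [g i j + g j i] to the multiplicity, where [g i j] is the
    right-hand side of [half_mult_translates].  If [nu k = nu l] is smaller than
    both [nu i] and [nu j], then this is 2 and [nu] lies on neither ray; if not,
    then it is 1 exactly when [nu] lies on one of them. *)
Lemma half_mult_sigma pi (i j k l : 'I_4) : uniq [:: i; j; k; l] ->
    pointlike_solid_partition pi ->
  exists n : int,
    half_mult i k l (Z pi * dual (Z pi)) = (sigma i pi + sigma j pi)%:Z + n * 2.
Proof.
move=> Us; have Us' := uniq_swap Us.
move: pi; apply: solid_partition_ind => [|nu pi hpi hnupi nupi [n IH]].
  have sigma0 a : sigma a fset0 = 0%N.
    rewrite /sigma cardfs0 (_ : [fset nu in fset0 | on_diagonal_ray a nu] = fset0).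
      by rewrite cardfs0.
    by apply/fsetP => nu; rewrite !inE.
  exists 0; rewrite !sigma0 /half_mult /Z big_seq_fset0 mul0r mulr0.
  exact: triv_mult0.
have -> : Z (nu |` pi) = Z pi + lattice_mono (position nu).
  by rewrite !Z_lattice_mono big_fsetU1 //= addrC.
have step := half_norm_add (@gr_dualD character) (@gr_dualM character)
  (@gr_dualN character) (@gr_dual1 character) (@gr_dualK character)
  (@triv_multD character) (@triv_mult_dual character)
  (dual_tK j) (dual_tK k) (dual_tK l) (prod_dual_t Us) (Z pi)
  (mono_dualK (char_of (position nu))).
have half0 := half_mult1 Us; rewrite /half_mult mulr1 in half0.
have {}step : half_mult i k l
    ((Z pi + lattice_mono (position nu)) * dual (Z pi + lattice_mono (position nu))) =
    half_mult i k l (Z pi * dual (Z pi)) +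
    (half_mult i k l (Z pi * lattice_mono (- position nu)) +
     half_mult j k l (Z pi * lattice_mono (- position nu))).
  by rewrite -dual_lattice_mono; exact: step half0.
have tij := half_mult_translates Us hpi hnupi nupi.
have tji := half_mult_translates Us' hpi hnupi nupi.
(* The -1 compensates for the box itself, which both sigmas count. *)
exists (n + [&& nu k == nu l, nu k < nu i & nu k < nu j]%N%:Z - 1).
apply: (etrans step); apply: (etrans (congr2 +%R IH (congr2 +%R tij tji))).
rewrite !sigma_fsetU1 // (on_diagonal_rayE _ Us) (on_diagonal_rayE _ Us').
lia.
Qed.

(** * Comparison of the Euler classes *)

Lemma sign_cancel (F : fieldType) (r s : nat) (n : int) (x y : F) :
  x = y * (-1) ^ ((r + s)%:Z + n * 2) -> (-1) ^+ r * x = (-1) ^+ s * y.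
Proof.
have N1 : (-1 : F) != 0 by rewrite oppr_eq0 oner_eq0.
move=> ->; rewrite expfzDr // [n * 2]mulrC -exprz_exp -!exprnP.
by rewrite sqrrN expr1n exp1rz mulr1 exprD [y * _]mulrC -mulrA signrMK.
Qed.

Lemma v_expand (i j k l : 'I_4) pi : uniq [:: i; j; k; l] ->
  v i pi = Z pi - (1 - dual (t j)) * ((1 - dual (t k)) * (1 - dual (t l)))
                  * Z pi * dual (Z pi).
Proof. by move=> Us; rewrite /v (dual_P_compl1 Us). Qed.

Theorem theorem2p8 (pi : {fset box}) (hpi : pointlike_solid_partition pi)
    (i j : 'I_4) :
  (-1) ^+ sigma i pi * euler (- v i pi) = (-1) ^+ sigma j pi * euler (- v j pi).
Proof.
have [->//|/ord4_complete[k [l Us]]] := eqVneq i j.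
have Us' := uniq_swap Us.
have [n half_sigma] := half_mult_sigma Us hpi.
have swap : euler (- v i pi) =
    euler (- v j pi) * (-1) ^ half_mult i k l (Z pi * dual (Z pi)).
  rewrite (v_expand _ Us) (v_expand _ Us').
  have aug_tk V : aug (dual (t k) * V) = aug V.
    by rewrite dual_t_indicator; exact: aug_mono_mul.
  exact: (gr_euler_swap (dual_tK j) (dual_tK k) (dual_tK l) (prod_dual_t Us)
            aug_tk weightN weight_eq0 (Z pi)).
by move: swap; rewrite half_sigma; exact: sign_cancel.
Qed.
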